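(* Let $d\ge1$ be an integer and let $\alpha^*$ be the asymptotic density of a maximum independent set in the random $d$-regular graph, i.e. $\alpha^*=\lim_{N\to\infty}\frac1N\mathbb E\bigl[\max_{I\in\mathcal I(G_N)}|I|\bigr]$. For $\beta\ge1$, $q\in[0,1]$ and $\alpha\in\mathbb R$ let $$\Phi^{(1)}(\beta,q,\alpha)=\log\bigl(1+(\beta-1)(1-q)^d\bigr)-\frac d2\log\Bigl(1-q^2\bigl(1-\tfrac1\beta\bigr)\Bigr)-\alpha\log\beta,$$ let $\Phi^{(1)}(\alpha)=\inf_{q\in[0,1],\,\beta\ge1}\Phi^{(1)}(\beta,q,\alpha)$ and $\alpha^{(1)}=\inf\{\alpha>0:\ \Phi^{(1)}(\alpha)<0\}$. Then $\Phi^{(1)}(\beta,q,\alpha^* )\ge0$ for all $\beta\ge1$ and $q\in[0,1]$, and hence $\alpha^*\le\alpha^{(1)}$.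
   Context: For $N$ with $dN$ even, $G_N$ is the random $d$-regular multigraph on $N$ vertices given by the configuration model (each vertex carries $d$ half-edges and a uniformly random pairing of the $dN$ half-edges is taken). An independent set of a graph is a subset $I$ of its vertices such that no edge joins two vertices $v_1,v_2\in I$ (loops included: $v_1=v_2$ allowed); $\mathcal I(G_N)$ is the set of independent sets of $G_N$. It is a known theorem of Bayati, Gamarnik and Tetali that the limit defining $\alpha^*$ exists. *)

(* Defs.v *)
From HB Require Import structures.
From mathcomp Require Import all_boot all_order all_algebra.
From mathcomp Require Import all_classical all_reals all_analysis.

Set Implicit Arguments.
Unset Strict Implicit.
Unset Printing Implicit Defensive.

Import Order.TTheory GRing.Theory Num.Theory.
Import numFieldNormedType.Exports.

Local Open Scope classical_set_scope.
Local Open Scope ring_scope.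

(* The half-edge (v, k) is the k-th half-edge carried by the vertex v. *)
Definition half_edge (N d : nat) : finType := ('I_N * 'I_d)%type.

(* A pairing of the half-edges is encoded by the function sending each
   half-edge to its partner, i.e. by an involution without fixed points. *)
Definition pairings (N d : nat) : {set {ffun half_edge N d -> half_edge N d}} :=
  [set s : {ffun half_edge N d -> half_edge N d}
    | [forall h, (s (s h) == h) && (s h != h)]]%SET.

(* Adjacency in the multigraph obtained from the pairing s.  It may relate a
   vertex to itself (loop); multiplicities of edges are irrelevant to
   independent sets. *)
Definition config_adj (N d : nat) (s : {ffun half_edge N d -> half_edge N d}) :
    rel 'I_N :=
  fun v w => [exists h, (h.1 == v) && ((s h).1 == w)].

(* v = w is allowed, so a vertex carrying a loop lies in no independent set. *)
Definition independent (N : nat) (e : rel 'I_N) (I : {set 'I_N}) : bool :=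
  [forall v in I, forall w in I, ~~ e v w].

Definition max_independent (N : nat) (e : rel 'I_N) : nat :=
  (\max_(I : {set 'I_N} | independent e I) #|I|)%N.

(* Expectation over a uniformly random pairing. *)
Definition mean_max_independent (R : realType) (d N : nat) : R :=
  (\sum_(s in pairings N d) (max_independent (config_adj s))%:R)
    / #|pairings N d|%:R.

(* The limit is taken along the integers N such that d * N is even, the others
   admitting no pairing. *)
Definition alpha_star (R : realType) (d : nat) : R :=
  lim ((fun N : nat => N%:R^-1 * mean_max_independent R d N)
         @ within [set N : nat | ~~ odd (d * N)] \oo).

Definition Phi1 (R : realType) (d : nat) (beta q alpha : R) : R :=
  ln (1 + (beta - 1) * (1 - q) ^+ d)
  - d%:R / 2 * ln (1 - q ^+ 2 * (1 - 1 / beta))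
  - alpha * ln beta.

(* The infimum is -oo for some alpha (e.g. alpha > 1, with q = 0 and
   beta -> +oo), hence the extended reals. *)
Definition Phi1_inf (R : realType) (d : nat) (alpha : R) : \bar R :=
  ereal_inf [set (Phi1 d p.1 p.2 alpha)%:E | p in
              [set p : R * R | 1 <= p.1 /\ 0 <= p.2 <= 1]].

(* This set is bounded below by 0 and contains every alpha > 1, so the real
   infimum is not a default value. *)
Definition alpha1 (R : realType) (d : nat) : R :=
  inf [set alpha : R | 0 < alpha /\ (Phi1_inf d alpha < 0)%E].

(* Main.v *)
Require Import Defs.
From mathcomp Require Import all_classical all_reals all_analysis.
From mathcomp Require Import all_boot all_order all_algebra.
From mathcomp Require Import ring lra zify.
Import Order.TTheory GRing.Theory Num.Theory.
Import numFieldNormedType.Exports.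

Set Implicit Arguments.
Unset Strict Implicit.
Unset Printing Implicit Defensive.

Local Open Scope ring_scope.

(** The upper bound on the independence ratio is the annealed form of a
    combinatorial interpolation at inverse temperature ln beta.

    Write gam = 1 / beta and describe a set I of vertices by a cost: the number
    of vertices outside I plus the number of edges inside I.  Deleting one
    endpoint of each violated edge shows that the minimal cost is N - alpha(G),
    where alpha(G) is the largest size of an independent set, so that
    E[beta ^ alpha(G)] is, up to the factor gam ^ N, the mean of gam to the
    minimal cost (weight).  By Jensen's inequality it suffices to bound this mean
    (jensen_expR, finite_bound).

    The graph is built by attaching objects to half-edges that are still free:
    an edge joins two uniform free half-edges; a field sits at one uniform free
    half-edge and, with probability q, charges 1 to every I containing its
    vertex.  If f is the fraction of free half-edges that are frozen, i.e.
    occupied in every ground state, one more edge multiplies the mean by about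
    1 - (1 - gam) f^2 and one more field by at least 1 - (1 - gam) q f.  With
    kappa = 1 - (1 - gam) q^2 (edge_factor), the inequality 2 q f <= q^2 + f^2 reads
      kappa + (1 - (1 - gam) f^2) <= 2 (1 - (1 - gam) q f):
    a field dominates the average of an edge and of nothing weighted by kappa
    (edge_field_tradeoff).  This is linear in the mean, hence it can be iterated
    with no concentration argument: starting from 2t fields, each field is
    replaced by nothing or by an edge, and we keep those sequences of choices
    which end with t edges and never use more half-edges than there are.
    Ballot numbers count them; there are 4^t of them up to a polynomial factor,
    which cancels the 2^(2t) and leaves kappa ^ (- t) (mixed_mean_ballot).

    At one end the fields decouple the vertices and give
    (gam (1 + (beta - 1) (1 - q)^d))^N (field_mean_le).  At the other end t random
    edges form part of a uniform perfect matching, whose remaining edges only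
    raise the cost (matching_mean_le_iter).  Keeping K half-edges free during the
    interpolation makes sampling without replacement cost a factor
    1 + beta / K per step; with N = 4 k^2 and K = 2 k all errors are O(1 / k)
    after taking logarithms and dividing by N.  Passing to the limit along
    these N gives the bound on alpha_star; if the limit did not exist,
    alpha_star would be the default value 0, for which the bound is clear. *)

(** * Ground states and frozen half-edges *)

Section GroundState.
Variables (T : finType) (x0 : T).

Definition ground (c : T -> nat) : nat := c [arg min_(x < x0) c x].

Lemma ground_le (c : T -> nat) x : (ground c <= c x)%N.
Proof. by rewrite /ground; case: arg_minnP => // y _; apply. Qed.

Lemma ground_attained (c : T -> nat) : exists x, c x = ground c.
Proof. by exists [arg min_(x < x0) c x]. Qed.

Definition addc (c e : T -> nat) : T -> nat := fun x => (c x + e x)%N.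

Lemma addcAC (c e e' : T -> nat) : addc (addc c e) e' = addc (addc c e') e.
Proof. by apply/funext => x; rewrite /addc addnAC. Qed.

Lemma ground_addc (c e : T -> nat) : (ground c <= ground (addc c e))%N.
Proof.
have [x xE] := ground_attained (addc c e); rewrite -xE.
exact: leq_trans (ground_le c x) (leq_addr _ _).
Qed.

Lemma ground_addc_le (c e : T -> nat) n : (forall x, (e x <= n)%N) ->
  (ground (addc c e) <= ground c + n)%N.
Proof.
move=> en; have [x xE] := ground_attained c; rewrite -xE.
by apply: leq_trans (ground_le _ x) _; rewrite leq_add2l.
Qed.

End GroundState.

Section Frozen.
Variables (T H : finType) (x0 : T) (o : H -> T -> bool).

Definition edge_cost (h h' : H) : T -> nat := fun x => o h x && o h' x.
Definition field_cost (h : H) : T -> nat := fun x => o h x.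

(** A half-edge is frozen when its vertex is occupied in every ground state;
    only then does a charge on it raise the minimal cost. *)
Definition frozen (c : T -> nat) (h : H) : bool :=
  [forall x, (c x == ground x0 c) ==> o h x].

Lemma ground_field (c : T -> nat) (h : H) :
  (ground x0 (addc c (field_cost h)) <= ground x0 c + frozen c h)%N.
Proof.
case: (boolP (frozen c h)) => [_|/forallPn[x]].
  by apply: ground_addc_le => x; rewrite /field_cost; case: (o h x).
rewrite negb_imply => /andP[/eqP xE /negbTE ohx].
by apply: leq_trans (ground_le _ _ x) _; rewrite /addc /field_cost ohx xE.
Qed.

(** Costs are integers, so a configuration which is not a ground state already
    costs at least one more than the minimum. *)
Lemma ground_edge (c : T -> nat) (h h' : H) :
  (ground x0 c + (frozen c h && frozen c h')
     <= ground x0 (addc c (edge_cost h h')))%N.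
Proof.
case: (boolP (_ && _)) => [/andP[/forallP fh /forallP fh']|_]; last first.
  by rewrite addn0; apply: ground_addc.
have [x <-] := ground_attained x0 (addc c (edge_cost h h')).
rewrite /addc /edge_cost; move: (fh x) (fh' x) (ground_le x0 c x).
rewrite leq_eqVlt eq_sym; case: eqP => [-> /= -> -> _|_ /= _ _ lt] //.
by rewrite addn1 (leq_trans lt) // leq_addr.
Qed.

End Frozen.

(** * Attaching random edges and random fields *)

Section Operators.
Variables (R : realFieldType) (T H : finType) (o : H -> T -> bool) (q : R).

(** States consist of a cost c and the set F of free half-edges.  The operators
    below average a function of the state over the next random attachment; an
    average over no choice at all is 0. *)
Definition add_edge (g : (T -> nat) -> {set H} -> R) (c : T -> nat) (F : {set H}) : R :=
  (\sum_(h in F) \sum_(h' in F :\ h) g (addc c (edge_cost o h h')) (F :\ h :\ h'))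
  / (#|F| * #|F|.-1)%:R.

Definition add_field (g : (T -> nat) -> {set H} -> R) (c : T -> nat) (F : {set H}) : R :=
  (\sum_(h in F) ((1 - q) * g c (F :\ h) + q * g (addc c (field_cost o h)) (F :\ h)))
  / #|F|%:R.

Lemma card_setD1 (F : {set H}) h : h \in F -> #|F :\ h| = #|F|.-1.
Proof. by move=> hF; rewrite (cardsD1 h F) hF. Qed.

Lemma exchange_triple (F : {set H}) (f : H -> H -> H -> R) :
  \sum_(h in F) \sum_(h' in F :\ h) \sum_(k in F :\ h :\ h') f h h' k =
  \sum_(k in F) \sum_(h in F :\ k) \sum_(h' in F :\ k :\ h) f h h' k.
Proof.
under eq_bigr => h hF.
  rewrite (exchange_big_dep (mem (F :\ h))) /=; last first.
    by move=> h' k _; rewrite !inE => /andP[].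
  over.
rewrite (exchange_big_dep (mem F)) /=; last first.
  by move=> h k _; rewrite !inE => /andP[].
apply: eq_bigr => k kF; apply: eq_big => [h|h].
  by rewrite !inE kF andbT eq_sym andbC.
rewrite !inE kF andbT => /andP[_ kh].
by apply: eq_bigl => h'; rewrite !inE kF kh !andbT andbC (eq_sym k) andbCA.
Qed.

(** Both sides average over ordered triples of distinct free half-edges.  Thanks
    to this exchange, any attachment may be regarded as the last one. *)
Lemma add_edge_add_field g : add_edge (add_field g) = add_field (add_edge g).
Proof.
apply/funext => c; apply/funext => F; rewrite /add_edge /add_field.
pose f h h' k :=
  (1 - q) * g (addc c (edge_cost o h h')) (F :\ h :\ h' :\ k)
  + q * g (addc (addc c (edge_cost o h h')) (field_cost o k)) (F :\ h :\ h' :\ k).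
transitivity ((\sum_(h in F) \sum_(h' in F :\ h) \sum_(k in F :\ h :\ h') f h h' k)
   / (#|F| * #|F|.-1 * #|F|.-2)%:R).
  rewrite [in RHS]natrM invfM mulrA mulrAC; congr (_ * _).
  rewrite mulr_suml; apply: eq_bigr => h hF.
  rewrite mulr_suml; apply: eq_bigr => h' h'F.
  by rewrite !card_setD1.
rewrite exchange_triple -mulnA natrM invfM [_ * (_ * _)]mulrA mulrAC; congr (_ * _).
rewrite mulr_suml; apply: eq_bigr => k kF.
rewrite !card_setD1 // !mulrA -mulrDl; congr (_ * _).
rewrite !mulr_sumr -big_split /=; apply: eq_bigr => h hF.
rewrite !mulr_sumr -big_split /=; apply: eq_bigr => h' h'F.
rewrite /f [addc (addc c (field_cost o k)) _]addcAC.
have -> // : F :\ h :\ h' :\ k = F :\ k :\ h :\ h'.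
by apply/setP => z; rewrite !inE; do !case: (_ == _).
Qed.

(** The interpolation compares three functions of the state at a fixed number
    of free half-edges; such linear inequalities survive averaging. *)
Definition le_comb (a b : R) n (f g h : (T -> nat) -> {set H} -> R) :=
  forall c (F : {set H}), #|F| = n -> a * f c F + g c F <= b * h c F.

Hypotheses (q0 : 0 <= q) (q1 : q <= 1).

Lemma le_comb_add_field a b n f g h :
  le_comb a b n f g h -> le_comb a b n.+1 (add_field f) (add_field g) (add_field h).
Proof.
move=> le c F Fn; rewrite /add_field !mulrA -mulrDl ler_wpM2r ?invr_ge0 ?ler0n //.
rewrite !mulr_sumr -big_split /=; apply: ler_sum => k kF.
have Fk : #|F :\ k| = n by rewrite card_setD1 // Fn.
have := le (addc c (field_cost o k)) _ Fk; have := le c _ Fk.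
have : 0 <= 1 - q by rewrite subr_ge0.
move: (1 - q) => p p0 l1 l2.
have := ler_wpM2l p0 l1; have := ler_wpM2l q0 l2; lra.
Qed.

Lemma le_comb_add_edge a b n f g h :
  le_comb a b n f g h -> le_comb a b n.+2 (add_edge f) (add_edge g) (add_edge h).
Proof.
move=> le c F Fn; rewrite /add_edge !mulrA -mulrDl ler_wpM2r ?invr_ge0 ?ler0n //.
rewrite !mulr_sumr -big_split /=; apply: ler_sum => k kF.
rewrite !mulr_sumr -big_split /=; apply: ler_sum => k' k'F.
by apply: le; rewrite !card_setD1 // Fn.
Qed.

Lemma le_comb_iter a b n m t f g h : le_comb a b n f g h ->
  le_comb a b (n + m + 2 * t) (iter t add_edge (iter m add_field f))
    (iter t add_edge (iter m add_field g)) (iter t add_edge (iter m add_field h)).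
Proof.
move=> le; elim: t => [|t IHt].
  rewrite muln0 addn0; elim: m => [|m IHm]; first by rewrite addn0.
  by rewrite addnS; apply: le_comb_add_field.
have -> : (n + m + 2 * t.+1 = (n + m + 2 * t).+2)%N by lia.
exact: le_comb_add_edge.
Qed.

Lemma iter_add_field_add_edge m g : iter m add_field (add_edge g) = add_edge (iter m add_field g).
Proof. by elim: m => //= m ->; rewrite add_edge_add_field. Qed.

End Operators.

(** * Central binomial coefficients and ballot numbers *)

Section CentralBinomial.

(** From the ratio 2 (2n + 1) / (n + 1) of consecutive central binomials. *)
Lemma central_bin_lower n : (4 ^ n <= (2 * n).+1 * 'C(2 * n, n))%N.
Proof.
elim: n => // n IHn.
have e : (n.+1 * 'C(2 * n.+1, n.+1) = 2 * ((2 * n).+1 * 'C(2 * n, n)))%N.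
  have := mul_bin_diag (2 * n).+2 n; have := mul_bin_down (2 * n).+1 n.
  rewrite (_ : 2 * n.+1 = (2 * n).+2)%N /=; last lia.
  rewrite (_ : (2 * n).+1 - n = n.+1)%N; last lia.
  move: 'C(_, _) 'C(_, _) 'C(_, _) => x y z; nia.
by rewrite expnS; nia.
Qed.

(** The difference of binomials is the Catalan number. *)
Lemma ballot_count (n : nat) : (n.+1 * ('C(2 * n, n) - 'C(2 * n, n.+1)) = 'C(2 * n, n))%N.
Proof.
have := mul_bin_left (2 * n) n.
have -> : (2 * n - n = n)%N by lia.
nia.
Qed.

Lemma ballot_lower (R : numDomainType) (n : nat) :
  4 ^+ n <= (n.+1 * (2 * n).+1)%:R * ('C(2 * n, n)%:R - 'C(2 * n, n.+1)%:R) :> R.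
Proof.
have := mul_bin_left (2 * n) n; rewrite (_ : 2 * n - n = n)%N; last lia.
move=> e; have le : ('C(2 * n, n.+1) <= 'C(2 * n, n))%N by nia.
rewrite -natrB // -natrM -natrX ler_nat mulnAC ballot_count mulnC.
exact: central_bin_lower.
Qed.

End CentralBinomial.

(** * The interpolation inequality *)

Section Interpolation.
Variables (R : realFieldType) (T H : finType) (x0 : T) (o : H -> T -> bool).
Variables (gam q : R).
Hypotheses (gam0 : 0 < gam) (gam1 : gam <= 1) (q0 : 0 <= q) (q1 : q <= 1).

(** The weight depends on the cost alone; it takes F as an argument to be a
    function of the state. *)
Definition weight (c : T -> nat) (F : {set H}) : R := gam ^+ ground x0 c.
Definition edge_factor : R := 1 - q ^+ 2 * (1 - gam).

(** Turns integral increments of the minimal cost into multiplicative factors. *)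
Lemma expr_addb n (b : bool) : gam ^+ (n + b) = gam ^+ n * (1 - (1 - gam) * b%:R).
Proof. by case: b => /=; rewrite ?addn1 ?addn0 ?exprSr; ring. Qed.

Lemma edge_factor_gt0 : 0 < edge_factor.
Proof.
move: gam0 gam1 q0 q1 => g0 g1 z0 z1.
rewrite /edge_factor.
have : q ^+ 2 * (1 - gam) <= 1 * (1 - gam).
  by apply: ler_wpM2r; [rewrite subr_ge0 | rewrite expr_le1].
lra.
Qed.

(** Ordered pairs of distinct frozen half-edges number k (k - 1). *)
Lemma sum_frozen_pairs (F : {set H}) (phi : H -> bool) :
  let k : R := \sum_(h in F) (phi h)%:R in
  \sum_(h in F) \sum_(h' in F :\ h) (phi h && phi h')%:R = k ^+ 2 - k :> R.
Proof.
move=> k; have step h : h \in F ->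
    \sum_(h' in F :\ h) (phi h && phi h')%:R = (phi h)%:R * k - (phi h)%:R :> R.
  move=> hF; under eq_bigr do rewrite -mulnb natrM.
  rewrite -mulr_sumr [k](big_setD1 h) //=.
  by case: (phi h) => /=; ring.
by rewrite (eq_bigr _ step) sumrB -mulr_suml -expr2.
Qed.

Definition frozen_count (c : T -> nat) (F : {set H}) : R :=
  \sum_(h in F) (frozen x0 o c h)%:R.

Lemma add_edge_weight_le c (F : {set H}) : (1 < #|F|)%N ->
  add_edge o weight c F <= weight c F
    * (1 - (1 - gam) * ((frozen_count c F ^+ 2 - frozen_count c F) / (#|F| * #|F|.-1)%:R)).
Proof.
move=> F2; have n0 : 0 < (#|F| * #|F|.-1)%:R :> R.
  by rewrite ltr0n; case: #|F| F2 => [|[]].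
rewrite /add_edge ler_pdivrMr // -sum_frozen_pairs.
set S2 := (X in X / _).
have -> : weight c F * (1 - (1 - gam) * (S2 / (#|F| * #|F|.-1)%:R)) * (#|F| * #|F|.-1)%:R
  = \sum_(h in F) \sum_(h' in F :\ h) weight c F
       * (1 - (1 - gam) * (frozen x0 o c h && frozen x0 o c h')%:R).
  under eq_bigr do rewrite -mulr_sumr sumrB -mulr_sumr.
  rewrite -mulr_sumr sumrB -mulr_sumr -/S2.
  have -> : \sum_(h in F) \sum_(h' in F :\ h) 1 = (#|F| * #|F|.-1)%:R :> R.
    rewrite natrM mulr_natl -sumr_const; apply: eq_bigr => h hF.
    by rewrite sumr_const card_setD1.
  by move: _%:R n0 => n n0; field; rewrite gt_eqF.
apply: ler_sum => h hF; apply: ler_sum => h' h'F.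
rewrite /weight -expr_addb ler_wiXn2l ?gam1 ?(ltW gam0) //; apply: ground_edge.
Qed.

Lemma add_field_weight_ge c (F : {set H}) : (0 < #|F|)%N ->
  weight c F * (1 - (1 - gam) * q * (frozen_count c F / #|F|%:R)) <= add_field o q weight c F.
Proof.
move: gam0 gam1 q0 q1 => g0 g1 z0 z1.
move=> F1; have n0 : 0 < #|F|%:R :> R by rewrite ltr0n.
rewrite /add_field ler_pdivlMr //.
have -> : weight c F * (1 - (1 - gam) * q * (frozen_count c F / #|F|%:R)) * #|F|%:R
  = \sum_(h in F) weight c F * (1 - (1 - gam) * q * (frozen x0 o c h)%:R).
  rewrite -mulr_sumr sumrB -mulr_sumr -/(frozen_count c F) sumr_const.
  by move: _%:R n0 => n n0; field; rewrite gt_eqF.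
apply: ler_sum => h hF.
have : gam ^+ (ground x0 c + frozen x0 o c h) <= weight (addc c (field_cost o h)) F.
  by rewrite /weight ler_wiXn2l ?gam1 ?(ltW gam0) //; apply: ground_field.
rewrite expr_addb /weight => /(ler_wpM2l q0); lra.
Qed.

(** The convexity inequality 2 q f <= q^2 + f^2 with f = k / n, up to the
    difference between drawing with and without replacement.  That difference
    is at most 1 / K, and 1 - (1 - gam) q f >= gam turns it into a relative
    error. *)
Lemma frozen_frac_ineq (n k K : R) : 0 < K -> K + 1 <= n -> 0 <= k <= n ->
  edge_factor + (1 - (1 - gam) * ((k ^+ 2 - k) / (n * (n - 1))))
    <= 2 * (1 + (gam * K)^-1) * (1 - (1 - gam) * q * (k / n)).
Proof.
move: gam0 gam1 q0 q1 => g0 g1 z0 z1.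
move=> K0 Kn /andP[k0 kn].
have n0 : 0 < n by lra.
have n1 : 0 < n - 1 by lra.
pose f := k / n.
have f0 : 0 <= f by rewrite divr_ge0 // ltW.
have f1 : f <= 1 by rewrite ler_pdivrMr // mul1r.
have -> : (k ^+ 2 - k) / (n * (n - 1)) = f ^+ 2 - (f - f ^+ 2) / (n - 1).
  by rewrite /f; field; rewrite !gt_eqF.
rewrite -/f; have le1 : (f - f ^+ 2) / (n - 1) <= K^-1.
  rewrite ler_pdivrMr // mulrC ler_pdivlMr //; nra.
have gf : gam <= 1 - (1 - gam) * q * f.
  have : q * f <= 1 by nra.
  have : 0 <= q * f by nra.
  nra.
rewrite /edge_factor.
have le2 : (1 - gam) * K^-1 <= 2 * (gam * K)^-1 * (1 - (1 - gam) * q * f).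
  apply: (@le_trans _ _ (2 * (gam * K)^-1 * gam)); last first.
    by rewrite ler_wpM2l // mulr_ge0 // invr_ge0 mulr_ge0 ?ltW.
  have -> : 2 * (gam * K)^-1 * gam = 2 * K^-1 by field; rewrite !gt_eqF.
  by rewrite ler_wpM2r ?invr_ge0 ?(ltW K0) //; lra.
have le3 : (1 - gam) * ((f - f ^+ 2) / (n - 1)) <= (1 - gam) * K^-1.
  by rewrite ler_wpM2l // subr_ge0.
have le4 : 0 <= (1 - gam) * (q - f) ^+ 2 by rewrite mulr_ge0 ?sqr_ge0 ?subr_ge0.
move: le2 le3 le4; set A := (f - _) / _; set B := K^-1; set C := (gam * K)^-1.
rewrite sqrrB; lra.
Qed.

(** Attaching a field dominates the average of attaching an edge and attaching
    nothing with weight edge_factor. *)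
Lemma edge_field_tradeoff K n : (0 < K < n)%N ->
  le_comb edge_factor (2 * (1 + (gam * K%:R)^-1)) n
    weight (add_edge o weight) (add_field o q weight).
Proof.
move=> /andP[K0 Kn] c F Fn.
have KR : 0 < K%:R :> R by rewrite ltr0n.
have D0 : 0 <= 2 * (1 + (gam * K%:R)^-1).
  by rewrite mulr_ge0 // addr_ge0 // invr_ge0 mulr_ge0 ?ltW.
have F1 : (1 < #|F|)%N by rewrite Fn; lia.
apply: le_trans (ler_wpM2l D0 (add_field_weight_ge _ (ltnW F1))).
apply: le_trans (lerD (lexx _) (add_edge_weight_le _ F1)) _.
set k := frozen_count c F.
rewrite [edge_factor * _]mulrC -mulrDr [X in _ <= X]mulrCA.
rewrite ler_wpM2l ?exprn_ge0 ?(ltW gam0) //.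
have := @frozen_frac_ineq n%:R k K%:R KR.
have -> : n%:R - 1 = n.-1%:R :> R by rewrite -subn1 natrB //; lia.
rewrite Fn -natrM natr1 ler_nat; apply => //.
rewrite /k /frozen_count sumr_ge0 //= -Fn -sumr_const.
by apply: ler_sum => h _; rewrite lern1 leq_b1.
Qed.

(** Mean weight after t random edges and m random fields. *)
Definition mixed_mean (c : T -> nat) (F : {set H}) t m : R :=
  iter t (add_edge o) (iter m (add_field o q) weight) c F.

Lemma mixed_mean_step K c (F : {set H}) t m : (0 < K)%N -> (2 * t + m + K < #|F|)%N ->
  edge_factor * mixed_mean c F t m + mixed_mean c F t.+1 m
    <= 2 * (1 + (gam * K%:R)^-1) * mixed_mean c F t m.+1.
Proof.
move=> K0 KF; have Kn : (0 < K < #|F| - 2 * t - m)%N by lia.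
have := le_comb_iter o q0 q1 (m := m) (t := t) (edge_field_tradeoff Kn).
move/(_ c F); rewrite iter_add_field_add_edge -iterSr -iterSr; apply; lia.
Qed.

Lemma mixed_mean_ge0 c (F : {set H}) t m : 0 <= mixed_mean c F t m.
Proof.
rewrite /mixed_mean.
have add_field0 g : (forall c F, 0 <= g c F) -> forall c F, 0 <= add_field o q g c F.
  move=> g0 c' F'; rewrite divr_ge0 // sumr_ge0 // => h _.
  by rewrite addr_ge0 ?mulr_ge0 // subr_ge0.
have add_edge0 g : (forall c F, 0 <= g c F) -> forall c F, 0 <= add_edge o g c F.
  move=> g0 c' F'; rewrite divr_ge0 // sumr_ge0 // => h _.
  by rewrite sumr_ge0.
have m0 : forall c F, 0 <= iter m (add_field o q) weight c F.
  by elim: m => [|m IHm] /=; [move=> ? ?; rewrite exprn_ge0 // ltW|apply: add_field0].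
by elim: t c F => //= t IHt; apply: add_edge0.
Qed.

(** Unrolls mixed_mean_step along paths from (t - s, m) to (t, 0), in which each
    of the m fields is dropped or becomes an edge, s of them becoming edges.
    The number of half-edges in use never exceeds 2t, i.e. m <= 2s at each
    point; by the reflection principle the number of such paths is
    'C(m, s) - 'C(m, s + 1), which satisfies Pascal's rule and vanishes on the
    line m = 2s + 1. *)
Lemma mixed_mean_ballot K c (F : {set H}) t : (0 < K)%N -> #|F| = (2 * t + K)%N ->
  forall m s, (m <= (2 * s).+1)%N -> (s <= t)%N ->
  edge_factor ^+ m * ('C(m, s)%:R - 'C(m, s.+1)%:R) * mixed_mean c F t 0
  <= edge_factor ^+ s * (2 * (1 + (gam * K%:R)^-1)) ^+ m * mixed_mean c F (t - s) m.
Proof.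
move: gam0 gam1 q0 q1 => g0 g1 z0 z1.
move=> K0 FE; set M := 2 * _; set X := mixed_mean c F t 0.
have k0 := edge_factor_gt0; have X0 : 0 <= X := mixed_mean_ge0 c F t 0.
have M0 : 0 <= M by rewrite mulr_ge0 // addr_ge0 // invr_ge0 mulr_ge0 ?ler0n ?ltW.
elim=> [|m IHm] s ms st.
  rewrite !bin0n expr0 mul1r mulr1; case: s st {ms} => [|s] st.
    by rewrite expr0 subn0 subr0 !mul1r.
  by rewrite subrr mul0r mulr_ge0 ?exprn_ge0 ?mixed_mean_ge0 // ltW.
(* on the line m + 1 = 2s + 1 the ballot number vanishes *)
have [ms'|ms'] := eqVneq m (2 * s)%N.
  have -> : 'C(m.+1, s.+1) = 'C(m.+1, s).
    by rewrite -bin_sub ?ms'; [congr binomial; lia|lia].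
  by rewrite subrr mulr0 mul0r !mulr_ge0 ?exprn_ge0 ?mixed_mean_ge0 // ltW.
have {ms'} ms : (m < 2 * s)%N by lia.
case: s st ms => // s st ms.
have le1 := IHm s.+1 ltac:(lia) st.
have le2 := IHm s ltac:(lia) (ltnW st).
have step : edge_factor * mixed_mean c F (t - s.+1) m + mixed_mean c F (t - s) m
    <= M * mixed_mean c F (t - s.+1) m.+1.
  have -> : (t - s)%N = (t - s.+1).+1 by lia.
  by apply: mixed_mean_step => //; rewrite FE; lia.
have p0 : 0 <= edge_factor ^+ s.+1 * M ^+ m by rewrite mulr_ge0 ?exprn_ge0 // ltW.
rewrite [M ^+ m.+1]exprSr mulrA -[X in _ <= X]mulrA.
apply: le_trans (ler_wpM2l p0 step).
have := lerD (ler_wpM2l (ltW k0) le1) (ler_wpM2l (ltW k0) le2).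
rewrite !binS !natrD !exprS; lra.
Qed.

End Interpolation.

(** * All half-edges carrying fields *)

Section FieldMean.
Variables (R : realFieldType) (T H : finType) (x0 : T) (o : H -> T -> bool).
Variables (gam q : R).
Hypotheses (gam0 : 0 < gam) (gam1 : gam <= 1) (q0 : 0 <= q) (q1 : q <= 1).

Lemma weight_addc_le (c e : T -> nat) (F : {set H}) : weight x0 gam (addc c e) F <= weight x0 gam c F.
Proof. by rewrite ler_wiXn2l ?(ltW gam0) // ground_addc. Qed.

Definition fields_cost (U : {set H}) : T -> nat := fun x => (\sum_(h in U) o h x)%N.

(** Law of a random subset containing each half-edge independently with
    probability q. *)
Definition bernoulli_mass (U : {set H}) : R := \prod_h (if h \in U then q else 1 - q).

Lemma bernoulli_mass_ge0 U : 0 <= bernoulli_mass U.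
Proof. by apply: prodr_ge0 => h _; case: ifP => // _; rewrite subr_ge0. Qed.

Lemma sum_bernoulli_mass : \sum_U bernoulli_mass U = 1.
Proof.
rewrite -(bigA_distr _ _ (fun=> q) (fun=> 1 - q)) big1 // => h _ /=; ring.
Qed.

(** Mean weight when independent fields are attached to all free half-edges. *)
Definition field_mean (c : T -> nat) (F : {set H}) : R :=
  \sum_U bernoulli_mass U * weight x0 gam (addc c (fields_cost (U :&: F))) F.

(** Each field raises the minimal cost by at most one. *)
Lemma weight_le_field_mean c (F : {set H}) :
  gam ^+ #|F| * weight x0 gam c F <= field_mean c F.
Proof.
rewrite -[X in X <= _]mul1r -sum_bernoulli_mass mulr_suml.
apply: ler_sum => U _; apply: ler_wpM2l; first exact: bernoulli_mass_ge0.
rewrite /weight -exprD ler_wiXn2l ?(ltW gam0) // addnC.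
apply: ground_addc_le => x; apply: (@leq_trans (\sum_(h in U :&: F) 1)%N).
  by apply: leq_sum => h _; apply: leq_b1.
by rewrite sum1_card subset_leq_card // subsetIr.
Qed.

Lemma sum_set_split h (f : {set H} -> R) :
  \sum_U f U = \sum_(U : {set H} | h \notin U) (f U + f (h |: U)).
Proof.
rewrite (bigID (fun U : {set H} => h \in U)) /= addrC big_split /=; congr (_ + _).
rewrite (reindex_onto (fun U => h |: U) (fun U => U :\ h)) /=; last first.
  by move=> U hU; rewrite setD1K.
apply: eq_bigl => U; rewrite setU11 /=; apply/eqP/idP => [<-|hU].
  by rewrite !inE eqxx.
by rewrite setU1K.
Qed.

(** Conditioning on the field at h. *)
Lemma field_mean_split c (F : {set H}) h : h \in F ->
  (1 - q) * field_mean c (F :\ h) + q * field_mean (addc c (field_cost o h)) (F :\ h)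
  = field_mean c F.
Proof.
move=> hF; rewrite /field_mean !(sum_set_split h) !mulr_sumr -big_split /=.
apply: eq_bigr => U hU.
have mU : bernoulli_mass U = (1 - q) * \prod_(k | k != h) (if k \in U then q else 1 - q).
  by rewrite /bernoulli_mass (bigD1 h) //= (negbTE hU).
have mhU : bernoulli_mass (h |: U) = q * \prod_(k | k != h) (if k \in U then q else 1 - q).
  rewrite /bernoulli_mass (bigD1 h) //= setU11; congr (_ * _).
  by apply: eq_bigr => k kh; rewrite !inE (negbTE kh).
have s1 : U :&: (F :\ h) = U :&: F.
  by apply/setP => k; rewrite !inE; case: eqP => [->|]; rewrite ?(negbTE hU).
have s2 : (h |: U) :&: (F :\ h) = U :&: F.
  by apply/setP => k; rewrite !inE; case: eqP => [->|]; rewrite ?(negbTE hU).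
have s3 : (h |: U) :&: F = h |: (U :&: F).
  by apply/setP => k; rewrite !inE; case: eqP => [->|] //=; rewrite hF.
have e : addc c (fields_cost (h |: (U :&: F)))
    = addc (addc c (field_cost o h)) (fields_cost (U :&: F)).
  apply/funext => x; rewrite /addc /fields_cost big_setU1 ?inE ?(negbTE hU) //=.
  by rewrite addnA.
rewrite s1 s2 s3 e mU mhU /weight; ring.
Qed.

(** Attaching one field at random and then all the others amounts to attaching
    all of them. *)
Lemma add_field_field_mean c (F : {set H}) : F != set0 -> add_field o q field_mean c F = field_mean c F.
Proof.
move=> F0; rewrite /add_field (eq_bigr (fun=> field_mean c F)); last first.
  by move=> h hF; apply: field_mean_split.
by rewrite sumr_const -(mulr_natr (field_mean c F)) mulfK // pnatr_eq0 cards_eq0.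
Qed.

Lemma iter_add_field_weight_le m K c (F : {set H}) : #|F| = (K + m)%N ->
  gam ^+ K * iter m (add_field o q) (weight x0 gam) c F <= field_mean c F.
Proof.
elim: m c F => [|m IHm] c F FE.
  by rewrite -[K]addn0 -FE; apply: weight_le_field_mean.
have F0 : F != set0 by rewrite -cards_eq0 FE addnS.
rewrite -add_field_field_mean // iterS.
have IH : le_comb 0 1 (K + m) (fun _ _ => 0)
   (fun c F => gam ^+ K * iter m (add_field o q) (weight x0 gam) c F) field_mean.
  by move=> c' F' F'E; rewrite mul0r add0r mul1r; apply: IHm.
have := le_comb_add_field o q0 q1 IH; rewrite /le_comb => /(_ c F).
rewrite FE addnS => /(_ erefl); rewrite mul0r add0r mul1r; apply: le_trans.
rewrite /add_field mulrA ler_wpM2r ?invr_ge0 ?ler0n // mulr_sumr.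
by apply: ler_sum => h _; rewrite mulrDr ![gam ^+ K * (_ * _)]mulrCA.
Qed.

End FieldMean.

(** * Uniform perfect matchings *)

Section Matchings.
Variable H : finType.

(** Encoded as involutions of the whole type whose set of moved points is F, so
    that matchings of different sets live in one type. *)
Definition matchings (F : {set H}) : {set {ffun H -> H}} :=
  [set s : {ffun H -> H} | [forall h, (s (s h) == h) && ((s h != h) == (h \in F))]].

(** join and cut add and remove the pair {h, h'}; they are mutually inverse
    between matchings of F minus {h, h'} and matchings of F pairing h with h'. *)
Definition join (h h' : H) (s : {ffun H -> H}) : {ffun H -> H} :=
  [ffun x => if x == h then h' else if x == h' then h else s x].

Definition cut (h h' : H) (s : {ffun H -> H}) : {ffun H -> H} :=
  [ffun x => if (x == h) || (x == h') then x else s x].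

Lemma matchingsP (F : {set H}) (s : {ffun H -> H}) :
  reflect ((forall h, s (s h) = h) /\ (forall h, (s h != h) = (h \in F)))
    (s \in matchings F).
Proof.
rewrite inE; apply: (iffP forallP) => [sP|[s1 s2] h].
  by split=> h; have /andP[/eqP ? /eqP ?] := sP h.
by rewrite s1 s2 !eqxx.
Qed.

(** Classifies the matchings of F by the partner h' of h. *)
Lemma sum_matchings (V : nmodType) (F : {set H}) h (G : {ffun H -> H} -> V) : h \in F ->
  \sum_(h' in F :\ h) \sum_(s in matchings (F :\ h :\ h')) G (join h h' s)
  = \sum_(s in matchings F) G s.
Proof.
move=> hF; rewrite [RHS](partition_big (fun s : {ffun H -> H} => s h) (mem (F :\ h))) /=; last first.
  move=> s /matchingsP[ss sF]; rewrite !inE sF hF /= -sF ss eq_sym.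
  by rewrite sF.
apply: eq_bigr => h' h'F.
have hh' : (h' == h) = false by move: h'F; rewrite !inE => /andP[/negbTE].
have h'inF : h' \in F by move: h'F; rewrite !inE => /andP[].
rewrite [RHS](reindex_onto (join h h') (cut h h')) /=; last first.
  move=> s /andP[/matchingsP[ss sF] /eqP sh]; apply/ffunP => x; rewrite !ffunE.
  case: eqP => [->|_] //=; case: eqP => [->|//].
  by rewrite -sh ss.
apply: eq_bigl => s; apply/matchingsP/andP.
  move=> [ss sF].
  have sh : s h = h by apply/eqP; rewrite -[_ == _]negbK sF !inE eqxx !andbF.
  have sh' : s h' = h' by apply/eqP; rewrite -[_ == _]negbK sF !inE eqxx.
  have out x : x != h -> x != h' -> (s x == h = false) * (s x == h' = false).
    move=> xh xh'; split; apply: contra_neqF xh => /eqP e.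
      by rewrite -(ss x) e sh.
    by move: xh'; rewrite -(ss x) e sh' eqxx.
  split; last first.
    apply/eqP/ffunP => x; rewrite !ffunE; case: eqP => [->|/eqP xh]; first by rewrite sh.
    by case: eqP => [->|] //=; rewrite sh'.
  apply/andP; split; last by rewrite ffunE eqxx.
  apply/matchingsP; split=> x; rewrite !ffunE.
    case: (eqVneq x h) => [->|xh]; first by rewrite hh' eqxx.
    case: (eqVneq x h') => [->|xh']; first by rewrite eqxx.
    by rewrite !out.
  case: (eqVneq x h) => [->|xh]; first by rewrite hh' hF.
  case: (eqVneq x h') => [->|xh']; first by rewrite eq_sym hh' h'inF.
  by rewrite sF !inE xh xh'.
move=> [/andP[/matchingsP[jj jF] _] /eqP <-].
have jh : join h h' s h = h' by rewrite ffunE eqxx.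
have jh' : join h h' s h' = h by rewrite ffunE hh' eqxx.
move: (join h h' s) jj jF jh jh' => j jj jF jh jh'.
have jout x : x != h -> x != h' -> (j x == h = false) * (j x == h' = false).
  move=> xh xh'; split; apply/negP => /eqP e.
    by move: xh'; rewrite -(jj x) e jh eqxx.
  by move: xh; rewrite -(jj x) e jh' eqxx.
split=> x; rewrite !ffunE.
  case: (eqVneq x h) => [->|xh] /=; first by rewrite eqxx.
  case: (eqVneq x h') => [->|xh'] /=; first by rewrite eqxx orbT.
  by rewrite !jout //= jj.
rewrite !inE -jF; case: (eqVneq x h) => [->|xh] /=; first by rewrite eqxx andbF.
by case: (eqVneq x h') => [->|xh'] /=; first by rewrite eqxx.
Qed.

(** The double factorial (n - 1)!! for even n, and 0 for odd n. *)
Fixpoint nmatchings (n : nat) : nat :=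
  if n is n'.+1 then if n' is n''.+1 then (n' * nmatchings n'')%N else 0%N else 1%N.

Lemma nmatchingsE n : nmatchings n.+2 = (n.+1 * nmatchings n)%N.
Proof. by []. Qed.

Lemma nmatchings_gt0 n : (0 < nmatchings (2 * n))%N.
Proof.
elim: n => // n IHn; rewrite (_ : 2 * n.+1 = (2 * n).+2)%N; last lia.
by rewrite nmatchingsE muln_gt0.
Qed.

Lemma card_matchings (F : {set H}) : #|matchings F| = nmatchings #|F|.
Proof.
have [n] := ubnP #|F|; elim: n F => // n IHn F /ltnSE Fn.
have [->|[h hF]] := set_0Vmem F.
  rewrite cards0 /= (_ : matchings set0 = [set [ffun x => x]]) ?cards1 //.
  apply/setP => s; rewrite in_set1; apply/matchingsP/eqP.
    by move=> [_ s0]; apply/ffunP => x; rewrite ffunE; apply/eqP; rewrite -[_ == _]negbK s0 inE.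
  by move=> ->; split=> x; rewrite !ffunE // eqxx inE.
have := sum_matchings (fun=> 1%N) hF; rewrite sum1_card => <-.
have Fh := card_setD1 hF.
rewrite (eq_bigr (fun=> nmatchings #|F|.-2)); last first.
  move=> h' h'F; rewrite sum1_card IHn card_setD1 // Fh //.
  by move: Fn hF; rewrite (cardsD1 h F); case: (h \in F) => //; lia.
rewrite sum_nat_const Fh; have : (0 < #|F|)%N by apply/card_gt0P; exists h.
by case: #|F| => // -[|m] _.
Qed.

End Matchings.

Section MatchingMean.
Variables (R : realFieldType) (T H : finType) (x0 : T) (o : H -> T -> bool).
Variable gam : R.
Hypotheses (gam0 : 0 < gam) (gam1 : gam <= 1).

(** The number of violated edges; each is seen from both of its half-edges,
    hence the halving. *)
Definition matching_cost (s : {ffun H -> H}) : T -> nat :=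
  fun x => #|[set h | [&& s h != h, o h x & o (s h) x]]|./2.

Lemma matching_cost_join (F : {set H}) h h' s : h \in F -> h' \in F :\ h ->
  s \in matchings (F :\ h :\ h') ->
  matching_cost (join h h' s) = addc (edge_cost o h h') (matching_cost s).
Proof.
move=> hF h'F /matchingsP[ss sF]; apply/funext => x.
rewrite /addc /edge_cost /matching_cost.
have hh' : h' != h by move: h'F; rewrite !inE => /andP[].
have sh : s h = h by apply/eqP; rewrite -[_ == _]negbK sF !inE eqxx !andbF.
have sh' : s h' = h' by apply/eqP; rewrite -[_ == _]negbK sF !inE eqxx.
rewrite (cardsD1 h) [in X in (_ + X)./2](cardsD1 h').
set A := _ :\ h'; set B := [set k | [&& s k != k, _ & _]].
have -> : A = B.
  apply/setP => k; rewrite !inE !ffunE.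
  case: (eqVneq k h') => [->|kh'] /=; first by rewrite sh' eqxx.
  by case: (eqVneq k h) => [->|kh] /=; first by rewrite sh eqxx.
rewrite !inE !ffunE !eqxx (negbTE hh') (eq_sym h) (negbTE hh') /=.
by rewrite addnA (andbC (o h' x)) addnn halfD odd_double doubleK.
Qed.

Definition matching_mean (c : T -> nat) (F : {set H}) : R :=
  (\sum_(s in matchings F) weight x0 gam (addc c (matching_cost s)) F)
    / #|matchings F|%:R.

(** Adding edges can only raise the minimal cost. *)
Lemma matching_mean_le_weight c F : matching_mean c F <= weight x0 gam c F.
Proof.
rewrite /matching_mean; have [->|M0] := eqVneq (#|matchings F|) 0%N.
  by rewrite invr0 mulr0 exprn_ge0 // ltW.
rewrite ler_pdivrMr ?ltr0n ?lt0n // mulr_natr -sumr_const.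
by apply: ler_sum => s _; apply: weight_addc_le.
Qed.

(** A uniform matching is a uniform pair of half-edges together with a uniform
    matching of the others. *)
Lemma matching_mean_le_add_edge c (F : {set H}) : (1 < #|F|)%N ->
  matching_mean c F <= add_edge o matching_mean c F.
Proof.
move=> F1; rewrite /add_edge /matching_mean card_matchings.
case FE: #|F| F1 => [|[|n]] // _; rewrite nmatchingsE /=.
rewrite [in leRHS](eq_bigr (fun=> (\sum_(s in matchings F) weight x0 gam (addc c (matching_cost s)) F) / (nmatchings n)%:R)); last first.
  move=> h hF; rewrite -(sum_matchings _ hF) mulr_suml; apply: eq_bigr => h' h'F.
  rewrite card_matchings !card_setD1 // FE /=; congr (_ / _).
  apply: eq_bigr => s sM; rewrite (matching_cost_join hF h'F sM).
  by congr (_ ^+ ground _ _); apply/funext => x; rewrite /addc addnA.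
rewrite sumr_const FE -[_ *+ n.+2]mulr_natl.
have n2 : n.+2%:R != 0 :> R by rewrite pnatr_eq0.
rewrite !natrM !invfM.
set S := \sum_(s in _) _.
have -> : n.+2%:R * (S / (nmatchings n)%:R) * (n.+2%:R^-1 * n.+1%:R^-1)
  = (n.+2%:R / n.+2%:R) * (S * (n.+1%:R^-1 * (nmatchings n)%:R^-1)) by ring.
by rewrite divff // mul1r.
Qed.

(** t edges of the matching are revealed one by one and the others are
    discarded. *)
Lemma matching_mean_le_iter c (F : {set H}) t : (2 * t <= #|F|)%N ->
  matching_mean c F <= iter t (add_edge o) (weight x0 gam) c F.
Proof.
elim: t c F => [|t IHt] c F tF; first exact: matching_mean_le_weight.
apply: le_trans (matching_mean_le_add_edge _ _) _; first lia.
have IH : le_comb 0 1 #|F|.-2 (fun _ _ => 0) matching_mean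
    (iter t (add_edge o) (weight x0 gam)).
  move=> c' F' F'E; rewrite mul0r add0r mul1r; apply: IHt; lia.
have := le_comb_add_edge o IH; rewrite /le_comb => /(_ c F).
by rewrite mul0r add0r mul1r; apply; lia.
Qed.

End MatchingMean.

(** * Comparison of the two endpoints *)

(** Interpolates between t random edges and 2t random fields, K half-edges being
    left free throughout. *)
Theorem matching_mean_bound (R : realFieldType) (T H : finType) (x0 : T)
    (o : H -> T -> bool) (gam q : R) (c : T -> nat) (t K : nat) :
  0 < gam <= 1 -> 0 <= q <= 1 -> (0 < K)%N -> #|H| = (2 * t + K)%N ->
  gam ^+ K * edge_factor gam q ^+ t * matching_mean x0 o gam c setT
  <= (t.+1 * (2 * t).+1)%:R * (1 + (gam * K%:R)^-1) ^+ (2 * t)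
     * field_mean x0 o gam q c setT.
Proof.
move=> /andP[g0 g1] /andP[q0 q1] K0 HE; rewrite -cardsT in HE.
have := @mixed_mean_ballot R T H x0 o gam q g0 g1 q0 q1 K c setT t K0 HE (2 * t)%N t (leqnSn _) (leqnn t).
rewrite subnn; set E := edge_factor _ _; set X := mixed_mean _ _ _ _ _ _ t 0.
have E0 : 0 < E := edge_factor_gt0 g0 g1 q0 q1.
have le1 : matching_mean x0 o gam c setT <= X.
  by apply: matching_mean_le_iter; rewrite // HE leq_addr.
have X0 : 0 <= X by apply: mixed_mean_ge0.
have le2 : gam ^+ K * mixed_mean x0 o gam q c setT 0 (2 * t) <= field_mean x0 o gam q c setT.
  by apply: iter_add_field_weight_le; rewrite // HE addnC.
set Y := mixed_mean _ _ _ _ _ _ 0 _ in le2 *; set D := 1 + _.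
have D0 : 0 <= D by rewrite addr_ge0 // invr_ge0 mulr_ge0 // ltW.
have g0K : 0 <= gam ^+ K by rewrite exprn_ge0 // ltW.
rewrite exprMn [2 ^+ _]exprM -[2 ^+ 2]/(2 * 2) -natrM [(2 * 2)%N]/= => bal.
have := ballot_lower R t; set w := _ - _ in bal *; set P := (_ * _)%:R => P4.
have P0 : 0 <= P by rewrite ler0n.
have {}bal : E ^+ t * (w * X) <= 4 ^+ t * D ^+ (2 * t) * Y.
  rewrite -(ler_pM2l (exprn_gt0 t E0)); move: bal.
  by rewrite {1}mul2n -addnn exprD -!mulrA.
have {}bal : E ^+ t * X <= P * (D ^+ (2 * t) * Y).
  have Dt : 0 < 4 ^+ t :> R by rewrite exprn_gt0.
  rewrite -(ler_pM2l Dt).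
  have h1 := ler_wpM2r (mulr_ge0 (exprn_ge0 t (ltW E0)) X0) P4.
  have h2 := ler_wpM2l P0 bal.
  clear -h1 h2; lra.
apply: le_trans (ler_wpM2l (mulr_ge0 g0K (exprn_ge0 t (ltW E0))) le1) _.
have Dn0 : 0 <= P * D ^+ (2 * t) by rewrite mulr_ge0 // exprn_ge0.
have h3 := ler_wpM2l g0K bal; have h4 := ler_wpM2l Dn0 le2.
lra.
Qed.

(** * The configuration model *)

Section RegularGraph.
Variables (R : realType) (N d : nat) (gam q : R).
Hypotheses (gam0 : 0 < gam) (gam1 : gam <= 1) (q0 : 0 <= q) (q1 : q <= 1).

Definition occupied (h : half_edge N d) (x : {set 'I_N}) : bool := h.1 \in x.
(** Cost of a set of vertices before any attachment. *)
Definition vacancies (x : {set 'I_N}) : nat := #|~: x|.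

(** A vertex carrying a nonzero field is either left out, or pays for that
    field. *)
Lemma hit_le_ground (U : {set half_edge N d}) :
  (#|[set v | [exists k, (v, k) \in U]]%SET|
     <= ground set0 (addc vacancies (fields_cost occupied U)))%N.
Proof.
have [x <-] := ground_attained set0 (addc vacancies (fields_cost occupied U)).
rewrite /addc /vacancies /fields_cost.
have -> : (\sum_(h in U) occupied h x = #|[set h in U | occupied h x]%SET|)%N.
  rewrite -sum1_card big_mkcond [RHS]big_mkcond /=; apply: eq_bigr => h _.
  by rewrite !inE; case: (h \in U) => //=; case: occupied.
apply: leq_trans (leq_add (leqnn _) (leq_imset_card fst _)).
apply: leq_trans (_ : #|~: x :|: [set h.1 | h in [set h in U | occupied h x]]%SET| <= _)%N;
  last exact: leq_card_setU.
apply/subset_leq_card/fintype.subsetP => v; rewrite !inE => /existsP[k vkU].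
case: (boolP (v \in x)) => //= vx; apply/imsetP; exists (v, k) => //.
by rewrite inE vkU.
Qed.

(** The number of vertices carrying a nonzero field is a sum of independent
    terms, so the mean is a product over the vertices: each of them carries no
    field with probability (1 - q)^d, and otherwise contributes gam. *)
Lemma field_mean_le :
  field_mean set0 occupied gam q vacancies [set: half_edge N d]%SET
  <= (gam + (1 - gam) * (1 - q) ^+ d) ^+ N.
Proof.
pose m (W : {set 'I_d}) : R := bernoulli_mass q W.
have one : \sum_W m W * (if W == set0 then 1 else gam) = gam + (1 - gam) * (1 - q) ^+ d.
  have m0 : m set0 = (1 - q) ^+ d.
    rewrite /m /bernoulli_mass (eq_bigr (fun=> 1 - q)) ?prodr_const ?card_ord //.
    by move=> k _; rewrite inE.
  rewrite (bigD1 set0) //= eqxx -m0.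
  rewrite (eq_bigr (fun W => m W * gam)); last by move=> W /negbTE ->.
  rewrite -mulr_suml; set S := \sum_(W | _) _.
  have e : m set0 + S = 1.
    by rewrite -(sum_bernoulli_mass 'I_d q) [RHS](bigD1 set0).
  rewrite (_ : S = 1 - m set0); last by rewrite -e addrC addKr.
  ring.
(* expands the product over the vertices into a sum over the choice, for each
   vertex, of the set of its half-edges carrying a nonzero field *)
rewrite -one -[X in _ ^+ X]card_ord -prodr_const bigA_distr_bigA /=.
rewrite /field_mean (reindex (fun f : {ffun 'I_N -> {set 'I_d}} =>
  [set h : half_edge N d | h.2 \in f h.1]%SET)) /=; last first.
  exists (fun U : {set half_edge N d} => [ffun v => [set k | (v, k) \in U]%SET]).
    by move=> f _; apply/ffunP => v; rewrite ffunE; apply/setP => k; rewrite !inE.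
  by move=> U _; apply/setP => -[v k]; rewrite !inE ffunE inE.
apply: ler_sum => f _; rewrite setIT big_split /=.
set U := [set h | _]%SET.
have -> : bernoulli_mass q U = \prod_v m (f v).
  rewrite /bernoulli_mass [RHS](pair_bigA _ (fun v k => if k \in f v then q else 1 - q)) /=.
  by apply: eq_bigr => -[v k] _; rewrite inE.
apply: ler_wpM2l; first by apply: prodr_ge0 => v _; apply: bernoulli_mass_ge0.
apply: le_trans (ler_wiXn2l (ltW gam0) gam1 (hit_le_ground U)) _.
rewrite -prodr_const big_mkcond /=; apply: ler_prod => v _.
rewrite inE; case: existsP => [_|nk]; first by rewrite (ltW gam0) /=; case: ifP.
rewrite ler01 /=; case: eqP => // /eqP/set0Pn[k kf]; case: nk; exists k.
by rewrite inE.
Qed.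

Lemma matchings_setT : matchings [set: half_edge N d]%SET = pairings N d.
Proof.
by apply/setP => s; rewrite !inE; apply: eq_forallb => h; rewrite inE eqb_id.
Qed.

Lemma max_independent_attained (e : rel 'I_N) :
  exists2 I : {set 'I_N}, independent e I & max_independent e = #|I|.
Proof.
have i0 : independent e set0 by apply/forallP => v; rewrite inE.
rewrite /max_independent (bigop.bigmax_eq_arg set0 i0) //.
by case: arg_maxnP => // I iI _; exists I.
Qed.

(** A maximum independent set violates no edge. *)
Lemma ground_matching_le (s : {ffun half_edge N d -> half_edge N d}) :
  (ground set0 (addc vacancies (matching_cost occupied s))
   <= N - max_independent (config_adj s))%N.
Proof.
have [I iI ->] := max_independent_attained (config_adj s).
apply: leq_trans (ground_le _ _ I) _.
rewrite /addc /matching_cost /vacancies cardsCs setCK card_ord.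
rewrite (_ : [set h | _]%SET = set0) ?cards0 ?addn0 //.
apply/setP => h; rewrite !inE; apply/negP => /and3P[_ hI shI].
move/forallP/(_ h.1)/implyP/(_ hI)/forallP/(_ (s h).1)/implyP/(_ shI): iI.
by move=> /negP; apply; apply/existsP; exists h; rewrite !eqxx.
Qed.

Lemma matching_mean_ge :
  (\sum_(s in pairings N d) gam ^+ (N - max_independent (config_adj s)))
    / #|pairings N d|%:R
  <= matching_mean set0 occupied gam vacancies [set: half_edge N d]%SET.
Proof.
rewrite /matching_mean matchings_setT ler_wpM2r ?invr_ge0 ?ler0n //.
apply: ler_sum => s _; apply: ler_wiXn2l (ltW gam0) gam1 _ _ _.
exact: ground_matching_le.
Qed.

End RegularGraph.

(** From the tangent line of the exponential at the mean. *)
Lemma jensen_expR (R : realType) (I : finType) (A : {set I}) (X : I -> R) :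
  (0 < #|A|)%N ->
  expR ((\sum_(i in A) X i) / #|A|%:R) <= (\sum_(i in A) expR (X i)) / #|A|%:R.
Proof.
move=> A0; have n0 : 0 < #|A|%:R :> R by rewrite ltr0n.
set m := (\sum_(i in A) X i) / _; rewrite ler_pdivlMr //.
have -> : expR m * #|A|%:R = \sum_(i in A) expR m * (1 + (X i - m)).
  rewrite -mulr_sumr big_split sumrB !sumr_const /= -[m *+ _]mulr_natr.
  by rewrite /m divfK ?gt_eqF // subrr addr0.
apply: ler_sum => i _; rewrite -{2}(subrK m (X i)) expRD mulrC.
by apply: ler_wpM2r; [exact: expR_ge0|exact: expR_ge1Dx].
Qed.

Lemma max_independent_le N (e : rel 'I_N) : (max_independent e <= N)%N.
Proof.
have [I _ ->] := max_independent_attained e.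
by rewrite -[X in (_ <= X)%N](card_ord N) max_card.
Qed.

(** The logarithm of matching_mean_bound, combined with Jensen's inequality. *)
Lemma finite_bound (R : realType) (d N t K : nat) (beta q : R) :
  1 <= beta -> 0 <= q <= 1 -> (0 < K)%N -> (d * N = 2 * t + K)%N -> ~~ odd K ->
  mean_max_independent R d N * ln beta
  <= N%:R * ln (1 + (beta - 1) * (1 - q) ^+ d)
     - t%:R * ln (1 - q ^+ 2 * (1 - 1 / beta))
     + ln (t.+1 * (2 * t).+1)%:R + (2 * t)%:R * (beta / K%:R) + K%:R * ln beta.
Proof.
move=> b1 /andP[q0 q1] K0 NE Keven.
have KE : (2 * t + K = 2 * (t + K./2))%N by clear -Keven; lia.
have b0 : 0 < beta by apply: lt_le_trans b1.
have bn0 : beta != 0 by rewrite gt_eqF.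
pose gam := beta^-1.
have g0 : 0 < gam by rewrite invr_gt0.
have g1 : gam <= 1 by rewrite invf_le1.
have gam01 : 0 < gam <= 1 by rewrite g0.
have q01 : 0 <= q <= 1 by rewrite q0.
have HE : #|half_edge N d| = (2 * t + K)%N.
  by rewrite card_prod !card_ord mulnC.
have K0R : 0 < K%:R :> R by rewrite ltr0n.
have := matching_mean_bound set0 (@occupied N d) (@vacancies N) gam01 q01 K0 HE.
set v := 1 + (beta - 1) * (1 - q) ^+ d.
have v1 : 1 <= v.
  by rewrite lerDl mulr_ge0 ?subr_ge0 // exprn_ge0 // subr_ge0.
have v0 : 0 < v by apply: lt_le_trans v1.
have fm : field_mean set0 (@occupied N d) gam q (@vacancies N) [set: half_edge N d]%SET
    <= gam ^+ N * v ^+ N.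
  apply: le_trans (field_mean_le _ _ g0 g1 q0 q1) _; rewrite -exprMn.
  by have -> : gam + (1 - gam) * (1 - q) ^+ d = gam * v by rewrite /v /gam; field.
set k := edge_factor gam q; set P := (_ * _)%:R; set D := 1 + _.
have k0 : 0 < k := edge_factor_gt0 g0 g1 q0 q1.
have P0 : 0 < P by rewrite ltr0n.
have D0 : 0 < D by rewrite addr_gt0 // invr_gt0 mulr_gt0.
have A0 : (0 < #|pairings N d|)%N.
  rewrite -matchings_setT card_matchings cardsT HE.
  by rewrite KE; apply: nmatchings_gt0.
have mm : gam ^+ N * expR (mean_max_independent R d N * ln beta)
    <= matching_mean set0 (@occupied N d) gam (@vacancies N) [set: half_edge N d]%SET.
  apply: le_trans (matching_mean_ge _ _ g0 g1).
  pose X s : R := (max_independent (@config_adj N d s))%:R * ln beta.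
  have -> : mean_max_independent R d N * ln beta
      = (\sum_(s in pairings N d) X s) / #|pairings N d|%:R.
    by rewrite /mean_max_independent mulrAC mulr_suml.
  have := ler_wpM2l (exprn_ge0 N (ltW g0)) (jensen_expR X A0).
  move/le_trans; apply; rewrite mulrA ler_wpM2r ?invr_ge0 ?ler0n // mulr_sumr.
  apply: ler_sum => s _; set a := max_independent _.
  have aN : (a <= N)%N by apply: max_independent_le.
  have -> : expR (X s) = beta ^+ a by rewrite /X -/a expRM_natl lnK ?posrE.
  have -> : gam ^+ N = gam ^+ (N - a) * gam ^+ a by rewrite -exprD subnK.
  by rewrite -mulrA -exprMn mulVf // expr1n mulr1.
move=> main.
have {}main : gam ^+ K * k ^+ t * expR (mean_max_independent R d N * ln beta)
    <= P * D ^+ (2 * t) * v ^+ N.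
  have gN : 0 < gam ^+ N by rewrite exprn_gt0.
  rewrite -(ler_pM2l gN) mulrCA [X in _ <= X]mulrCA.
  apply: le_trans (le_trans main _); apply: ler_wpM2l => //.
    by rewrite mulr_ge0 // exprn_ge0 // ltW.
  by rewrite mulr_ge0 ?exprn_ge0 // ltW.
have L0 : 0 < gam ^+ K * k ^+ t * expR (mean_max_independent R d N * ln beta).
  by rewrite !mulr_gt0 ?exprn_gt0 ?expR_gt0.
have lnD : ln D <= beta / K%:R.
  apply: le_trans (le_ln1Dx _) _.
    by apply: lt_trans (_ : 0 < _); rewrite ?ltrN10 // invr_gt0 mulr_gt0.
  by rewrite /gam invfM invrK.
move: main; rewrite -ler_ln ?posrE ?mulr_gt0 ?exprn_gt0 ?expR_gt0 //.
rewrite !lnM ?posrE ?mulr_gt0 ?exprn_gt0 ?expR_gt0 // expRK.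
rewrite !lnXn // -[ln gam *+ K]mulr_natl -[ln k *+ t]mulr_natl.
rewrite -[ln D *+ _]mulr_natl -[ln v *+ N]mulr_natl /gam lnV ?posrE //.
have -> : 1 - q ^+ 2 * (1 - 1 / beta) = k by rewrite div1r.
have := ler_wpM2l (ler0n R (2 * t)) lnD.
clear; lra.
Qed.

(** * Passage to the limit *)

Local Open Scope classical_set_scope.

Lemma ln_edge_le0 (R : realType) (beta q : R) : 1 <= beta -> 0 <= q <= 1 ->
  ln (1 - q ^+ 2 * (1 - 1 / beta)) <= 0.
Proof.
move=> b1 /andP[q0 q1]; have b0 : 0 < beta by apply: lt_le_trans b1.
apply: ln_le0; rewrite div1r gerBl mulr_ge0 ?exprn_ge0 // subr_ge0.
by rewrite invf_le1.
Qed.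

Lemma ln_vertex_ge0 (R : realType) (d : nat) (beta q : R) : 1 <= beta -> 0 <= q <= 1 ->
  0 <= ln (1 + (beta - 1) * (1 - q) ^+ d).
Proof.
move=> b1 /andP[q0 q1]; apply: ln_ge0.
by rewrite lerDl mulr_ge0 ?subr_ge0 // exprn_ge0 // subr_ge0.
Qed.

(** The choice K = 2k balances the two error terms 2t beta / K and K ln beta, both
    of order k, against N = 4 k^2. *)
Lemma square_bound (R : realType) (d k : nat) (beta q : R) :
  (0 < d)%N -> 1 <= beta -> 0 <= q <= 1 -> (0 < k)%N ->
  ((4 * k ^ 2)%:R^-1 * mean_max_independent R d (4 * k ^ 2)) * ln beta
  <= ln (1 + (beta - 1) * (1 - q) ^+ d)
     - d%:R / 2 * ln (1 - q ^+ 2 * (1 - 1 / beta))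
     + (8 * d%:R + 2 * d%:R * beta + 2 * ln beta) / 4 * k%:R^-1.
Proof.
move=> d0 b1 q01 k0; set N := (4 * k ^ 2)%N; pose t := (2 * d * k ^ 2 - k)%N.
have kk : (k <= 2 * d * k ^ 2)%N by nia.
have NE : (d * N = 2 * t + 2 * k)%N by rewrite /N /t; lia.
have Keven : ~~ odd (2 * k) by rewrite oddM.
have := finite_bound b1 q01 (_ : 0 < 2 * k)%N NE Keven; rewrite muln_gt0 k0 => /(_ isT).
have := ln_edge_le0 b1 q01; set lk := ln (1 - _) => lk0.
set lv := ln (1 + _ * _).
have lb : 0 <= ln beta by apply: ln_ge0.
have lP : ln (t.+1 * (2 * t).+1)%:R <= 8 * d%:R * k%:R :> R.
  (* a fourth power of a linear term in k, so that ln x <= x - 1 suffices *)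
  have le : (t.+1 * (2 * t).+1 <= (1 + 2 * d * k) ^ 4)%N.
    have h : ((2 * t).+1 <= (1 + 2 * d * k) ^ 2)%N by rewrite /t; nia.
    rewrite (expnM _ 2 2); set m := (_ ^ 2)%N in h *; nia.
  have y0 : 0 < (1 + 2 * d * k)%:R :> R by rewrite ltr0n.
  apply: (@le_trans _ _ (ln ((1 + 2 * d * k)%:R ^+ 4))).
    by rewrite ler_ln ?posrE ?exprn_gt0 ?ltr0n // -natrX ler_nat.
  rewrite lnXn // -[_ *+ 4]mulr_natl.
  have h : ln (1 + 2 * d * k)%:R <= (2 * d * k)%:R :> R.
    rewrite natrD; apply: le_ln1Dx.
    by apply: lt_le_trans (ltrN10 R) _; rewrite ler0n.
  apply: le_trans (ler_wpM2l (ler0n R 4) h) _; rewrite !natrM; lra.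
have kR : 0 < k%:R :> R by rewrite ltr0n.
have tR : t%:R <= d%:R * N%:R / 2 :> R.
  by rewrite ler_pdivlMr // -!natrM ler_nat NE; lia.
have lkt : - (t%:R * lk) <= - (d%:R * N%:R / 2 * lk).
  by rewrite lerN2 ler_wnM2r.
have NR : N%:R = 4 * k%:R ^+ 2 :> R by rewrite /N natrM natrX.
have N0 : 0 < N%:R :> R by rewrite NR mulr_gt0 // exprn_gt0.
have tb : (2 * t)%:R * (beta / (2 * k)%:R) <= 2 * d%:R * beta * k%:R.
  have b0 : 0 <= beta by apply: le_trans b1.
  rewrite mulrA ler_pdivrMr ?ltr0n ?muln_gt0 //.
  have : (2 * t)%:R <= d%:R * (4 * k%:R ^+ 2) :> R.
    by rewrite -NR -natrM ler_nat NE leq_addr.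
  move/(ler_wpM2r b0); rewrite natrM; lra.
move=> main.
rewrite mulrAC -mulrA mulrC ler_pdivrMr // mulrC.
have e2k : (2 * k)%:R * ln beta = 2 * k%:R * ln beta by rewrite natrM.
apply: le_trans main _; rewrite NR e2k [leRHS]mulrC.
have -> : 4 * k%:R ^+ 2 * (lv - d%:R / 2 * lk
     + (8 * d%:R + 2 * d%:R * beta + 2 * ln beta) / 4 * k%:R^-1)
   = 4 * k%:R ^+ 2 * lv - d%:R * (4 * k%:R ^+ 2) / 2 * lk
     + (8 * d%:R + 2 * d%:R * beta + 2 * ln beta) * k%:R.
  by field; rewrite gt_eqF.
rewrite NR in lkt; lra.
Qed.

(** The integers 4 k^2 keep d * N even for every d, so the limit may be computed
    along them. *)
Lemma alpha_star_bound (R : realType) (d : nat) (beta q : R) :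
  (0 < d)%N -> 1 <= beta -> 0 <= q <= 1 ->
  alpha_star R d * ln beta
  <= ln (1 + (beta - 1) * (1 - q) ^+ d)
     - d%:R / 2 * ln (1 - q ^+ 2 * (1 - 1 / beta)).
Proof.
move=> d0 b1 q01; rewrite /alpha_star; set u := (fun N : nat => _).
set W := within _ _.
have [cv|/dvgP ->] := pselect (cvg (u @ W)); last first.
  (* without convergence, lim is the default point 0 *)
  rewrite [point]/(0 : R) mul0r addr_ge0 ?ln_vertex_ge0 // oppr_ge0.
  by rewrite mulr_ge0_le0 ?ln_edge_le0 // divr_ge0.
have sub : (fun k : nat => (4 * k.+1 ^ 2)%N) @ \oo --> W.
  move=> A; rewrite /W /within /= => -[n _ nA]; exists n => // k /= nk.
  apply: nA => /=; first by nia.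
  by rewrite !oddM /= andbF.
have cu := cvg_comp _ _ sub cv.
have cl := cvgM cu (cvg_cst (ln beta)).
set L := ln _ - _; pose C : R := (8 * d%:R + 2 * d%:R * beta + 2 * ln beta) / 4.
have cr : (fun k : nat => L + C * k.+1%:R^-1) @ \oo --> L.
  rewrite -[X in _ --> X]addr0; apply: cvgD; first exact: cvg_cst.
  rewrite -[X in _ --> X](mulr0 C).
  by apply: cvgM; [exact: cvg_cst|exact: cvg_harmonic].
apply: ler_cvg_to (cl _ _) cr _.
by apply: nearW => k; apply: square_bound.
Qed.

Theorem mainTheorem4 (R : realType) (d : nat) (hd : (1 <= d)%N) :
  (forall beta q : R, 1 <= beta -> 0 <= q <= 1 ->
     0 <= Phi1 d beta q (alpha_star R d))
  /\ alpha_star R d <= alpha1 R d.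
Proof.
have Phi0 beta q : 1 <= beta -> 0 <= q <= 1 -> 0 <= Phi1 d beta q (alpha_star R d).
  by move=> b1 q01; rewrite /Phi1 subr_ge0; apply: alpha_star_bound.
split=> //; apply: lb_le_inf.
  (* alpha = 2 is in the set: at q = 0, beta = 2 the functional is (1 - alpha) ln 2 *)
  exists 2; split=> //.
  apply: (@le_lt_trans _ _ (Phi1 d 2 0 2)%:E).
    by apply: ereal_inf_lbound; exists (2, 0) => //=; rewrite ler1n lexx ler01.
  have l2 : 0 < ln 2 :> R by apply: ln_gt0; rewrite ltr1n.
  rewrite lte_fin /Phi1 subr0 expr1n expr0n /= mul0r subr0 ln1 mulr0 mulr1 subr0.
  rewrite (_ : 1 + (2 - 1) = 2 :> R); last ring.
  lra.
move=> alpha [_ /ereal_inf_lt[_ [[beta q] /= [b1 q01] <-]]].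
rewrite lte_fin => neg; have := Phi0 beta q b1 q01.
move: neg; rewrite /Phi1; set A := (ln _ - _) => neg pos.
have lb : 0 <= ln beta by apply: ln_ge0.
rewrite leNgt; apply/negP => lt.
have := ler_wpM2r lb (ltW lt); lra.
Qed.
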